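(* Let $\{M_{sp}\}_{s\in\mathcal S,p\in\mathcal P}$ be a POVM on a Hilbert space $Q$, $t:\mathcal S\times\mathcal P\to\mathcal X$ a function, and $\mathcal M:Q\to SPX$ the channel $\mathcal M(\rho)=\sum_{s,p}\mathrm{Tr}(\rho M_{sp})|s,p\rangle\langle s,p|\otimes|t(s,p)\rangle\langle t(s,p)|$. Let $\rho^\star$ be the density operator obtained in the first step of Algorithm 2 (context), and let $\mathbf f=y^\star\in\mathbb R^{|\mathcal X|}$ be the vector returned by Algorithm 2. Assuming that $\sum_{x}\mathbf f(x)M_x\le\nabla W(\rho^\star)$ is satisfied, the function $f(q)=\sum_x\mathbf f(x)q(x)$ is a valid min-tradeoff function for $\mathcal M$, i.e. $$f(q)\le\min_{\nu\in\Sigma(q)}H(S|PR)_\nu\qquad\text{for all }q\in\mathbb P(\mathcal X).$$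
   Context: $\log=\log_2$; $\mathbb P(\mathcal X)$ is the set of probability vectors on the finite set $\mathcal X$; $H(\cdot|\cdot)$ is von Neumann conditional entropy. $\Sigma(q)=\{\nu_{SPXR}=(\mathcal M\otimes\mathrm{id}_R)(\omega_{QR}):\omega\in\mathrm D(Q\otimes R),\ \nu_X=q\}$ with $R\cong Q$; the minimum over the empty set is $+\infty$. Let $M_p=\sum_sM_{sp}$, $M_x=\sum_{(s,p):t(s,p)=x}M_{sp}$, $H(\sigma)=-\mathrm{Tr}\,\sigma\log\sigma$ for $\sigma\ge0$, $\mathcal K_{sp}(\rho)=\sqrt{M_{sp}}\rho\sqrt{M_{sp}}$, $\mathcal K_p(\rho)=\sqrt{M_p}\rho\sqrt{M_p}$, and $W(\rho)=\sum_{s,p}H(\mathcal K_{sp}(\rho))-\sum_pH(\mathcal K_p(\rho))$, which equals $H(S|PR)$ of $(\mathcal M\otimes\mathrm{id}_R)(\rho_{QR})$ for a purification $\rho_{QR}$ of $\rho$. Its gradient, for $\rho>0$, is $\nabla W(\rho)=-\sum_{s,p}\mathcal K_{sp}^\dagger(\log\mathcal K_{sp}(\rho))+\sum_p\mathcal K_p^\dagger(\log\mathcal K_p(\rho))$ (logarithms on the support); $\rho^\star$ is taken to be a point where this gradient is well defined. Algorithm 2, on input $q_0\in\mathbb P(\mathcal X)$ and constants $c_0,c_1$: (1) compute a nearly optimal solution $\rho^\star$ of: minimize $W(\rho)-\sqrt{c_0^2-(\sum_x\xi(x))^2/(4c_1^2)}$ over density operators $\rho$ and $\xi\in\mathbb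 R^{|\mathcal X|}$ subject to $-\xi(x)\le\mathrm{Tr}(\rho M_x)-q_0(x)\le\xi(x)$ for all $x$ and $\sum_x\xi(x)\le2c_0c_1$; (2) solve: maximize $\mathbf f\cdot q_0-c_0\sqrt{1+c_1^2[\max_x\mathbf f(x)-\min_x\mathbf f(x)]^2}$ over $\mathbf f\in\mathbb R^{|\mathcal X|}$ subject to $\sum_x\mathbf f(x)M_x\le\nabla W(\rho^\star)$, and return $y^\star=\mathbf f$. *)

(* Defs.v *)
From HB Require Import structures.
From mathcomp Require Import all_boot all_order all_algebra.
From mathcomp Require Import complex mxtens.
From mathcomp Require Import mathcomp_extra boolp classical_sets reals ereal.
From mathcomp Require Import topology normedtype exp.

Set Implicit Arguments.
Unset Strict Implicit.
Unset Printing Implicit Defensive.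

Import Order.TTheory GRing.Theory Num.Theory.
Import numFieldNormedType.Exports.

Local Open Scope ring_scope.
Local Open Scope complex_scope.
Local Open Scope sesquilinear_scope.

(* A Hilbert space of dimension n is C^n, so that operators on it are the
   matrices 'M[R[i]]_n; a classical register over a finite alphabet T is
   C^#|T|, with basis vector 'e_(enum_rank x) for x : T; tensor products are
   those of mxtens.  Logarithms are in base 2. *)

Section Operators.
Variable R : realType.
Local Notation C := R[i].

Definition psdmx n (A : 'M[C]_n) : Prop :=
  A \is hermsymmx /\ forall v : 'rV[C]_n, 0 <= (v *m A *m v ^t*) 0 0.

Definition loewner_le n (A B : 'M[C]_n) : Prop := psdmx (B - A).

Definition densitymx n (A : 'M[C]_n) : Prop := psdmx A /\ \tr A = 1.

(* Functional calculus for a Hermitian matrix A = U^-1 diag(d) U: f is applied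
   to the eigenvalues, which are real. *)
Definition mxfun n (f : R -> R) (A : 'M[C]_n) : 'M[C]_n :=
  invmx (spectralmx A)
    *m diag_mx (map_mx (fun z : C => (f (complex.Re z))%:C) (spectral_diag A))
    *m spectralmx A.

Definition log2 (x : R) : R := ln x / ln 2.

Definition sqrtmx n (A : 'M[C]_n) : 'M[C]_n := mxfun Num.sqrt A.

(* Logarithm on the support: zero eigenvalues are mapped to 0. *)
Definition logmx n (A : 'M[C]_n) : 'M[C]_n :=
  mxfun (fun x => if x == 0 then 0 else log2 x) A.

(* Not normalised: meant for every A >= 0, for which the trace below is real. *)
Definition entropy n (A : 'M[C]_n) : R := - complex.Re (\tr (A *m logmx A)).

Definition basis_proj (T : finType) (x : T) : 'M[C]_#|T| :=
  delta_mx (enum_rank x) (enum_rank x).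

(* Writing A on C^m (x) C^k as sum_{r,r'} A_{rr'} (x) |r><r'|, this is A_{rr'}. *)
Definition tensblock m k (A : 'M[C]_(m * k)) (r r' : 'I_k) : 'M[C]_m :=
  \matrix_(i, j) A (mxtens_index (i, r)) (mxtens_index (j, r')).

(* Phi (x) id_k *)
Definition tensid m n k (Phi : 'M[C]_m -> 'M[C]_n) (A : 'M[C]_(m * k)) :
    'M[C]_(n * k) :=
  \sum_(r < k) \sum_(r' < k) Phi (tensblock A r r') *t delta_mx r r'.

(* Partial traces over the left and over the right tensor factor. *)
Definition ptracel m k (A : 'M[C]_(m * k)) : 'M[C]_k :=
  \matrix_(r, r') \tr (tensblock A r r').

Definition ptracer m k (A : 'M[C]_(m * k)) : 'M[C]_m :=
  \sum_(r < k) tensblock A r r.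

Definition is_prob (T : finType) (q : T -> R) : Prop :=
  (forall x, 0 <= q x) /\ \sum_x q x = 1.

End Operators.

Section Measurement.
Variables (R : realType) (n : nat) (S P X : finType).
Local Notation C := R[i].
Variables (M : S -> P -> 'M[C]_n) (t : S -> P -> X).

Definition is_povm : Prop :=
  (forall s p, psdmx (M s p)) /\ \sum_s \sum_p M s p = 1%:M.

Definition povmP (p : P) : 'M[C]_n := \sum_s M s p.

Definition povmX (x : X) : 'M[C]_n := \sum_s \sum_(p | t s p == x) M s p.

Definition channel (rho : 'M[C]_n) : 'M[C]_(#|S| * #|P| * #|X|) :=
  \sum_s \sum_p \tr (rho *m M s p) *:
    (basis_proj R s *t basis_proj R p *t basis_proj R (t s p)).

(* A state nu on S P X R, with R isomorphic to Q, is a matrix of size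
   ((#|S| * #|P|) * #|X|) * n. *)
Definition marginalX (nu : 'M[C]_(#|S| * #|P| * #|X| * n)) : 'M[C]_#|X| :=
  ptracel (ptracer nu).

Definition marginalSPR (nu : 'M[C]_(#|S| * #|P| * #|X| * n)) :
    'M[C]_(#|S| * #|P| * n) :=
  tensid (@ptracer R (#|S| * #|P|) #|X|) nu.

Definition marginalPR (nu : 'M[C]_(#|S| * #|P| * #|X| * n)) :
    'M[C]_(#|P| * n) :=
  tensid (@ptracel R #|S| #|P|) (marginalSPR nu).

(* H(S|PR) *)
Definition condent (nu : 'M[C]_(#|S| * #|P| * #|X| * n)) : R :=
  entropy (marginalSPR nu) - entropy (marginalPR nu).

Definition Sigma (q : X -> R) : set 'M[C]_(#|S| * #|P| * #|X| * n) :=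
  [set nu | (exists2 omega : 'M[C]_(n * n),
               densitymx omega & nu = tensid channel omega) /\
            marginalX nu = \sum_x (q x)%:C *: basis_proj R x].

(* ereal_inf of the empty set is +oo. *)
Definition min_tradeoff (f : (X -> R) -> R) : Prop :=
  forall q, is_prob q ->
    ((f q)%:E <= ereal_inf [set (condent nu)%:E | nu in Sigma q])%E.

(* For M s p and povmP p respectively, the maps K(rho) = sqrt A rho sqrt A
   and their adjoints for the Hilbert-Schmidt inner product. *)
Definition kmap (A rho : 'M[C]_n) : 'M[C]_n := sqrtmx A *m rho *m sqrtmx A.

Definition kmap_adj (A Y : 'M[C]_n) : 'M[C]_n :=
  (sqrtmx A) ^t* *m Y *m (sqrtmx A) ^t*.

Definition W (rho : 'M[C]_n) : R :=
  \sum_s \sum_p entropy (kmap (M s p) rho)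
  - \sum_p entropy (kmap (povmP p) rho).

Definition gradW (rho : 'M[C]_n) : 'M[C]_n :=
  - \sum_s \sum_p kmap_adj (M s p) (logmx (kmap (M s p) rho))
  + \sum_p kmap_adj (povmP p) (logmx (kmap (povmP p) rho)).

(* The logarithms in gradW, taken on the support, give the gradient of W as
   soon as each K(rho) has the largest support that sqrt A _ sqrt A allows,
   namely that of A (row spaces are compared; all matrices are Hermitian).
   This holds whenever rho is positive definite: see posdef_gradW_defined. *)
Definition gradW_defined (rho : 'M[C]_n) : Prop :=
  (forall s p, (M s p <= kmap (M s p) rho)%MS) /\
  (forall p, (povmP p <= kmap (povmP p) rho)%MS).

Section Algorithm.
Variables (q0 : X -> R) (c0 c1 : R).

Definition step1_feasible (rho : 'M[C]_n) (xi : X -> R) : Prop :=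
  [/\ densitymx rho,
      forall x, - xi x <= complex.Re (\tr (rho *m povmX x)) - q0 x <= xi x
    & \sum_x xi x <= 2 * c0 * c1].

Definition step1_objective (rho : 'M[C]_n) (xi : X -> R) : R :=
  W rho - Num.sqrt (c0 ^+ 2 - (\sum_x xi x) ^+ 2 / (4 * c1 ^+ 2)).

(* rho is the rho-component of a solution optimal up to the tolerance eps. *)
Definition step1_solution (eps : R) (rho : 'M[C]_n) : Prop :=
  exists2 xi, step1_feasible rho xi &
    forall rho' xi', step1_feasible rho' xi' ->
      step1_objective rho xi <= step1_objective rho' xi' + eps.

Definition step2_feasible (rho : 'M[C]_n) (f : X -> R) : Prop :=
  loewner_le (\sum_x (f x)%:C *: povmX x) (gradW rho).

(* X is finite, and nonempty as it carries the probability vector q0, so that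
   sup and inf are max and min. *)
Definition step2_objective (f : X -> R) : R :=
  \sum_x f x * q0 x
  - c0 * Num.sqrt (1 + c1 ^+ 2 * (sup (range f) - inf (range f)) ^+ 2).

(* f attains the maximum up to the tolerance delta.  Feasibility of f is not
   included: a numerical solver need not ensure it, so it is a separate
   hypothesis of the theorem. *)
Definition step2_optimal (delta : R) (rho : 'M[C]_n) (f : X -> R) : Prop :=
  forall f', step2_feasible rho f' ->
    step2_objective f' <= step2_objective f + delta.

End Algorithm.
End Measurement.

Section PosDef.
Variables (R : realType) (n : nat).
Local Notation C := R[i].
Implicit Types A rho : 'M[C]_n.

Lemma mxfun_adj (f : R -> R) A : (mxfun f A) ^t* = mxfun f A.
Proof.
rewrite /mxfun invmx_unitary ?spectral_unitarymx // !trmx_mul !map_mxM.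
rewrite trmxCK tr_diag_mx map_diag_mx -map_mx_comp mulmxA.
congr (_ *m diag_mx _ *m _); apply/matrixP => i j; rewrite !mxE /=.
by apply/eqP; rewrite eq_complex /= oppr0 !eqxx.
Qed.

Lemma psdmx_spectral_ge0 A j : psdmx A -> 0 <= spectral_diag A 0 j.
Proof.
move=> [Ah Age0].
have /hermitian_normalmx/orthomx_spectralP Ae := Ah.
have /unitarymxP UU := spectral_unitarymx A.
have := Age0 (row j (spectralmx A)).
rewrite [X in _ *m X *m _]Ae invmx_unitary ?spectral_unitarymx //.
set U := spectralmx A in UU *; set d := spectral_diag A.
have -> : row j U *m (U^t* *m diag_mx d *m U) *m (row j U)^t* =
    (d 0 j)%:M :> 'M_1.
  have -> : row j U *m (U^t* *m diag_mx d *m U) *m (row j U)^t* =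
      'e_j *m (U *m U^t*) *m diag_mx d *m (U *m U^t*) *m 'e_j^t*.
    by rewrite rowE trmx_mul map_mxM !mulmxA.
  rewrite UU !mulmx1.
  rewrite trmx_delta map_delta_mx /= -!rowE.
  apply/matrixP => a b; rewrite !ord1 !mxE.
  rewrite (bigD1 j) //= big1 => [|k kj]; last first.
    by rewrite !mxE (negPf kj) mulr0.
  by rewrite !mxE !eqxx mulr1 addr0.
by rewrite mxE eqxx mulr1n.
Qed.

Lemma sqrtmx_sqr A : psdmx A -> sqrtmx A *m sqrtmx A = A.
Proof.
move=> Apsd; have [Ah _] := Apsd.
have /hermitian_normalmx/orthomx_spectralP Ae := Ah.
rewrite [RHS]Ae /sqrtmx /mxfun !mulmxA mulmxK ?spectral_unit//.
congr (_ *m _); rewrite -mulmxA mulmx_diag; congr (_ *m diag_mx _).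
apply/matrixP => i j; rewrite !ord1 !mxE.
have := psdmx_spectral_ge0 j Apsd.
case: (spectral_diag A 0 j) => a b; rewrite lecE /= => /andP[/eqP -> a0].
by rewrite -rmorphM /= -expr2 sqr_sqrtr.
Qed.

Lemma kmap_posdef_support A rho : psdmx A ->
  (forall v : 'rV[C]_n, v != 0 -> 0 < (v *m rho *m v ^t*) 0 0) ->
  (A <= kmap A rho)%MS.
Proof.
move=> Apsd rho_gt0; rewrite submxE; set Y := cokermx _.
have KY : kmap A rho *m Y = 0 by exact: mulmx_coker.
rewrite -[X in X *m _](sqrtmx_sqr Apsd) -mulmxA.
suff -> : sqrtmx A *m Y = 0 by rewrite mulmx0.
move: KY (mxfun_adj Num.sqrt A); rewrite -/(sqrtmx A) /kmap.
move: (sqrtmx A) Y => B Y KY Badj; apply/trmx_inj/row_matrixP => j; rewrite -tr_col trmx0 row0; apply: (can_inj (@trmxK _ _ _)); rewrite trmxK trmx0 colE.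
rewrite -mulmxA; set u := Y *m _; set v : 'rV[C]_n := (B *m u) ^t*.
have Bu : B *m u = v ^t* by rewrite trmxCK.
have : v *m rho *m v ^t* = 0.
  rewrite -Bu /v trmx_mul map_mxM Badj -!mulmxA.
  suff -> : B *m (rho *m (B *m u)) = 0 by rewrite mulmx0.
  by rewrite /u !mulmxA KY mul0mx.
case: (eqVneq v 0) => [v0 _|/rho_gt0 + /matrixP/(_ 0 0)].
  by rewrite Bu v0 trmx0 map_mx0.
by move=> + e; rewrite e mxE ltxx.
Qed.

End PosDef.

Lemma posdef_gradW_defined (R : realType) n (S P : finType)
    (M : S -> P -> 'M[R[i]]_n) rho : is_povm M ->
  (forall v : 'rV_n, v != 0 -> 0 < (v *m rho *m v ^t*) 0 0) ->
  gradW_defined M rho.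
Proof.
move=> [Mpsd _] rho_gt0; split=> [s p|p]; apply: kmap_posdef_support => //.
split.
  apply/is_hermitianmxP; rewrite expr0 scale1r /povmP.
  rewrite raddf_sum map_mx_sum; apply: eq_bigr => s _.
  by have [/is_hermitianmxP + _] := Mpsd s p; rewrite expr0 scale1r.
move=> v; rewrite /povmP mulmx_sumr mulmx_suml summxE.
by apply: sumr_ge0 => s _; have [_] := Mpsd s p; apply.
Qed.

(* Main.v *)
Require Import Defs.
From mathcomp Require Import all_boot all_order all_algebra.
From mathcomp Require Import complex mxtens ring lra.
From mathcomp Require Import boolp classical_sets functions reals ereal.
From mathcomp Require Import topology normedtype exp realfun derive.

Set Implicit Arguments.
Unset Strict Implicit.
Unset Printing Implicit Defensive.

Import Order.TTheory GRing.Theory Num.Theory.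
Import numFieldNormedType.Exports.
Local Open Scope ring_scope.

(* For a state omega on QR write [omega = sum_e |psi_e><psi_e|], and regard each
   [psi_e] as a matrix from R to Q.  Then [omega_Q = sum_e psi_e psi_e^*], and
   outcome A leaves R in (the transpose of) [theta A = sum_e psi_e^* A psi_e].
   As [q(x) = Tr (omega_Q M_x)], feasibility of f gives
   [f(q) <= Tr (omega_Q gradW(rho))], so it is enough that, for every p,
     [sum_s gap (M_sp) <= gap (M_p)],
   where
     [gap A = Tr (theta A log (theta A))
              - Tr (omega_Q sqrt A log (sqrt A rho sqrt A) sqrt A)].
   Here [gap A] is the expectation, in the vectors [sqrt A psi_e], of the
   logarithm of the relative modular operator [K^-1 (x) theta A] with
   [K = sqrt A rho sqrt A], so the claim is a data processing inequality, and
   Petz's proof of monotonicity applies: for every t > 0 the expectations of the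
   resolvents are compared by a variational principle, and
     [d/dt log (x + t) = 1 / (x + t)]
   transfers the comparison to the logarithm.  As omega need not be pure, this
   replaces strong subadditivity as well as the convexity of W. *)

(** * From resolvents to logarithms *)

Section ScalarComparison.
Variables (R : realType) (I J : finType).

Lemma is_derive_sum_ln (K : finType) (a x : K -> R) (t : R) :
  (forall k, 0 < x k + t) ->
  is_derive t 1 (fun t => \sum_k a k * ln (x k + t)) (\sum_k a k / (x k + t)).
Proof.
move=> xt; have -> : (fun t => \sum_k a k * ln (x k + t)) =
    \sum_k ((fun t => a k * ln (x k + t)) : R -> R).
  by apply/funext => u; rewrite fct_sumE.
elim/big_ind2: _ => [|f df g dg|k _].
- exact: (is_derive_cst (0 : R)).
- exact: is_deriveD.
have dln := is_derive1_ln (xt k).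
apply: (@is_deriveZ _ R R (fun t => ln (x k + t)) (a k) t 1 (x k + t)^-1).
have dx : is_derive t 1 (fun t => x k + t) 1.
  have := is_deriveD (is_derive_cst (x k) t 1) (is_derive_id t 1).
  by rewrite add0r.
by have := is_derive1_comp dln dx; rewrite mulr1.
Qed.

(** Integrating the resolvent bound over t in [0, T] compares the logarithms up to boundary terms at
    T. These grow like ln T times the total weights, which agree, so they cancel as T tends to
    infinity. *)
Lemma sum_ln_le_of_resolvent (a x : I -> R) (b y : J -> R) :
  (forall i, 0 <= a i) -> (forall i, 0 < x i) ->
  (forall j, 0 <= b j) -> (forall j, 0 < y j) ->
  \sum_i a i = \sum_j b j ->
  (forall t : R, 0 < t -> \sum_j b j / (y j + t) <= \sum_i a i / (x i + t)) ->
  \sum_i a i * ln (x i) <= \sum_j b j * ln (y j).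
Proof.
move=> a0 x0 b0 y0 ab res.
(* F is nondecreasing on [0, +oo[ and F T = O(1/T), so F 0 <= 0. *)
pose F t := \sum_i a i * ln (x i + t) - \sum_j b j * ln (y j + t).
have dF (t : R) : 0 <= t ->
    is_derive t 1 F (\sum_i a i / (x i + t) - \sum_j b j / (y j + t)).
  move=> t0; apply: is_deriveB.
    by apply: is_derive_sum_ln => i; rewrite ltr_pwDl.
  by apply: is_derive_sum_ln => i; rewrite ltr_pwDl.
have F0T (T : R) : 0 < T -> F 0 <= F T.
  move=> T0.
  apply: (@ger0_derive1_ndecr _ F 0 T) => //; last exact: ltW.
  - move=> t; rewrite in_itv /= => /andP[t0 _].
    by have := dF t (ltW t0) => -[].
  - move=> t; rewrite in_itv /= => /andP[t0 _].
    have := dF t (ltW t0) => d; rewrite derive1E derive_val subr_ge0.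
    exact: res.
  - apply: derivable_within_continuous => t; rewrite in_itv /= => /andP[t0 _].
    by have := dF t t0 => -[].
(* Writing ln (u + T) = ln T + ln (1 + u / T), the ln T terms cancel by [ab]. Then ln (1 + u / T) is
   at most u / T in the first sum and nonnegative in the second. *)
have FT (T : R) : 0 < T -> F T <= (\sum_i a i * x i) / T.
  move=> T0.
  have lnT (u : R) : 0 < u -> ln (u + T) = ln T + ln (1 + u / T).
    move=> u0; rewrite -lnM ?posrE //; last first.
      by rewrite ltr_pwDl // divr_ge0 // ltW.
    by rewrite mulrDr mulr1 mulrCA divff ?gt_eqF // mulr1 addrC.
  rewrite /F.
  under eq_bigr do rewrite lnT // mulrDr.
  under [X in _ - X]eq_bigr do rewrite lnT // mulrDr.
  rewrite !big_split /= -!mulr_suml ab opprD addrACA subrr add0r.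
  rewrite lerBlDr mulr_suml -[X in X <= _]addr0; apply: lerD.
    apply: ler_sum => i _; rewrite -mulrA ler_wpM2l //.
    apply: le_ln1Dx; apply: (@lt_le_trans _ _ 0); rewrite ?oppr_lt0 //.
    by rewrite divr_ge0 // ltW.
  apply: sumr_ge0 => j _; rewrite mulr_ge0 // ln_ge0 // lerDl.
  by rewrite divr_ge0 // ltW.
rewrite -subr_le0.
have -> : \sum_i a i * ln (x i) - \sum_j b j * ln (y j) = F 0.
  by rewrite /F; congr (_ - _); apply: eq_bigr => i _; rewrite addr0.
set S := \sum_i a i * x i in FT.
have S0 : 0 <= S by apply: sumr_ge0 => i _; rewrite mulr_ge0 // ltW.
rewrite leNgt; apply/negP => F0.
(* If F 0 were positive, this T would give F 0 <= S / T = F 0 * S / (S + 1) < F 0. *)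
have T0 : 0 < (S + 1) / F 0 by rewrite divr_gt0 // ltr_wpDl.
have := le_trans (F0T _ T0) (FT _ T0).
rewrite invf_div mulrA ler_pdivlMr ?ltr_wpDl // mulrC ler_pM2r // gerDl.
by rewrite leNgt ltr01.
Qed.

End ScalarComparison.

(** The ratios w / u play the eigenvalues of a relative modular operator, and a the weights of a
    vector in its eigenbasis. Vanishing eigenvalues carry no weight, so their ratios can be replaced
    by any positive number. *)
Lemma sum_ln_ratio_le_of_resolvent (R : realType) (I J : finType)
    (a w u : I -> R) (b w' u' : J -> R) :
  (forall i, 0 <= a i) -> (forall i, 0 <= w i) -> (forall i, 0 <= u i) ->
  (forall j, 0 <= b j) -> (forall j, 0 <= w' j) -> (forall j, 0 <= u' j) ->
  (forall i, w i = 0 -> a i = 0) -> (forall i, u i = 0 -> a i = 0) ->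
  (forall j, w' j = 0 -> b j = 0) -> (forall j, u' j = 0 -> b j = 0) ->
  \sum_i a i = \sum_j b j ->
  (forall t : R, 0 < t -> \sum_j b j * u' j / (w' j + t * u' j) <=
                      \sum_i a i * u i / (w i + t * u i)) ->
  \sum_i a i * (ln (w i) - ln (u i)) <= \sum_j b j * (ln (w' j) - ln (u' j)).
Proof.
move=> a0 w0 u0 b0 w'0 u'0 aw au bw bu ab res.
(* The value 1 only serves to keep the ratio positive; wherever it is taken, the weight is 0. *)
pose r v z : R := if (v == 0) || (z == 0) then 1 else v / z.
have r0 v z : 0 <= v -> 0 <= z -> 0 < r v z.
  rewrite /r => v0 z0; case: ifP => // /norP[vN zN].
  by rewrite divr_gt0 // lt_def ?vN ?zN.
have lnr (c v z : R) : 0 <= v -> 0 <= z ->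
    (v = 0 -> c = 0) -> (z = 0 -> c = 0) ->
    c * (ln v - ln z) = c * ln (r v z).
  rewrite /r => v0 z0 cv cz.
  case: eqP => [/cv ->|/eqP vN]; first by rewrite !mul0r.
  case: eqP => [/cz ->|/eqP zN]; first by rewrite !mul0r.
  by rewrite /= ln_div ?posrE // lt_def ?vN ?zN.
have resr (c v z t : R) : 0 <= v -> 0 <= z ->
    (v = 0 -> c = 0) -> (z = 0 -> c = 0) ->
    0 < t -> c * z / (v + t * z) = c / (r v z + t).
  rewrite /r => v0 z0 cv cz t0.
  case: eqP => [/cv ->|/eqP vN]; first by rewrite !mul0r.
  case: eqP => [/cz ->|/eqP zN]; first by rewrite !mul0r.
  have zp : 0 < z by rewrite lt_def zN.
  have vp : 0 < v by rewrite lt_def vN.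
  have : 0 < v + t * z by rewrite addr_gt0 // mulr_gt0.
  by move=> /= h; field; rewrite zN gt_eqF.
under eq_bigr => i _ do rewrite (lnr _ _ _ (w0 i) (u0 i) (aw i) (au i)).
under [X in _ <= X]eq_bigr => i _ do
  rewrite (lnr _ _ _ (w'0 i) (u'0 i) (bw i) (bu i)).
apply: sum_ln_le_of_resolvent => // [i|j|t t0]; try exact: r0.
have := res t t0.
under eq_bigr => i _ do rewrite (resr _ _ _ _ (w'0 i) (u'0 i) (bw i) (bu i) t0).
by under [X in _ <= X]eq_bigr => i _ do
  rewrite (resr _ _ _ _ (w0 i) (u0 i) (aw i) (au i) t0).
Qed.

(** * The resolvent inequality *)

Section HilbertSchmidt.
Local Open Scope sesquilinear_scope.
Variable C : numClosedFieldType.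

Lemma adjmxM m n p (A : 'M[C]_(m, n)) (B : 'M_(n, p)) :
  (A *m B) ^t* = B ^t* *m A ^t*.
Proof. by rewrite trmx_mul map_mxM. Qed.

Lemma adjmxB m n (A B : 'M[C]_(m, n)) : (A - B) ^t* = A ^t* - B ^t*.
Proof. by rewrite linearB map_mxB. Qed.

Lemma unitarymx_adjK n (U : 'M[C]_n) : U \is unitarymx -> U ^t* *m U = 1%:M.
Proof. by move/unitarymxP/mulmx1C. Qed.

Lemma adj_unitarymx n (U : 'M[C]_n) : U \is unitarymx -> U ^t* \is unitarymx.
Proof. by move=> /unitarymx_adjK UU; apply/unitarymxP; rewrite trmxCK. Qed.

Definition hsprod m n (A B : 'M[C]_(m, n)) : C := \tr (A ^t* *m B).

Lemma hsprodE m n (A B : 'M[C]_(m, n)) :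
  hsprod A B = \sum_j \sum_k (A j k)^* * B j k.
Proof.
rewrite /hsprod /mxtrace exchange_big; apply: eq_bigr => k _.
by rewrite mxE; apply: eq_bigr => j _; rewrite !mxE.
Qed.

Lemma hsprodC m n (A B : 'M[C]_(m, n)) : (hsprod A B)^* = hsprod B A.
Proof.
rewrite !hsprodE rmorph_sum; apply: eq_bigr => j _.
by rewrite rmorph_sum; apply: eq_bigr => k _; rewrite rmorphM /= conjCK mulrC.
Qed.

Lemma hsprod_unitary m n (U : 'M[C]_m) (V : 'M_n) (A B : 'M_(m, n)) :
  U \is unitarymx -> V \is unitarymx ->
  hsprod (U *m A *m V) (U *m B *m V) = hsprod A B.
Proof.
move=> /unitarymx_adjK UU /unitarymxP VV.
rewrite /hsprod !adjmxM mulmxA mxtrace_mulC.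
by rewrite -!mulmxA (mulmxA V) VV mul1mx (mulmxA (U ^t*)) UU mul1mx.
Qed.

Lemma trace_weightedE m n (A B : 'M[C]_(m, n)) (d : 'rV_m) (w : 'rV_n) :
  \tr (A ^t* *m diag_mx d *m B *m diag_mx w) =
  \sum_j \sum_k (A j k)^* * d 0 j * B j k * w 0 k.
Proof.
rewrite /mxtrace exchange_big; apply: eq_bigr => k _.
rewrite mul_mx_diag mxE mxE mulr_suml; apply: eq_bigr => j _.
by rewrite mul_mx_diag !mxE.
Qed.

Lemma trace_weighted_rightE m n (A B : 'M[C]_(m, n)) (w : 'rV_n) :
  \tr (A ^t* *m B *m diag_mx w) = \sum_j \sum_k (A j k)^* * B j k * w 0 k.
Proof.
rewrite /mxtrace exchange_big; apply: eq_bigr => k _.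
rewrite mul_mx_diag mxE mxE mulr_suml; apply: eq_bigr => j _.
by rewrite !mxE.
Qed.

(** Completing the square: for d > 0 and c = w / d + t, the right side minus the left side is
    [|z - c * x| ^+ 2 / c]. For d = 0 the quotients and z are 0, which leaves - t |x|^2 <= 0. *)
Lemma resolvent_scalar (t d w x z : C) : 0 < t -> 0 <= d -> 0 <= w ->
  (d = 0 -> z = 0) ->
  x^* * z + z^* * x - t * (x^* * x) - w * (x^* * x) / d <=
  `|z| ^+ 2 * d / (w + t * d).
Proof.
move=> t0 d0 w0 dz; case: (eqVneq d 0) => [dE|dN].
  rewrite dE (dz dE) conjC0 !(mulr0, mul0r, add0r, invr0) subr0.
  by rewrite oppr_le0 mulr_ge0 ?(ltW t0) // mulrC mul_conjC_ge0.
have dp : 0 < d by rewrite lt_def dN.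
set c := w / d + t.
have cp : 0 < c by rewrite ltr_wpDl // divr_ge0.
have wE : w = (c - t) * d by rewrite /c addrK divfK.
have -> : w + t * d = c * d by rewrite wE; ring.
have -> : `|z| ^+ 2 * d / (c * d) = `|z| ^+ 2 / c.
  by field; rewrite gt_eqF.
have -> : w * (x^* * x) / d = (c - t) * (x^* * x).
  by rewrite wE; field.
rewrite -subr_ge0.
have cC : c^* = c by apply: CrealP; rewrite realE ltW.
have -> : `|z| ^+ 2 / c -
    (x^* * z + z^* * x - t * (x^* * x) - (c - t) * (x^* * x)) =
    `|z - c * x| ^+ 2 / c.
  rewrite !normCK rmorphB rmorphM /= cC.
  by field; rewrite gt_eqF.
by rewrite divr_ge0 ?exprn_ge0 // ltW.
Qed.

(** This says that sending B D to the family of the Bs s D is isometric; it is the isometry behind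
    the data processing inequality. *)
Lemma hsprod_sum_sqr m n (S : finType) (B : 'M[C]_m) (Bs : S -> 'M_m)
    (D E : 'M_(m, n)) :
  B ^t* = B -> (forall s, (Bs s) ^t* = Bs s) ->
  B *m B = \sum_s Bs s *m Bs s ->
  hsprod (B *m D) (B *m E) = \sum_s hsprod (Bs s *m D) (Bs s *m E).
Proof.
move=> BB BBs B2; rewrite /hsprod adjmxM BB -mulmxA (mulmxA B) B2.
rewrite mulmx_suml mulmx_sumr raddf_sum; apply: eq_bigr => s _ /=.
by rewrite adjmxM BBs !mulmxA.
Qed.

Section Resolvent.
Variables (m n : nat) (S : finType) (rho : 'M[C]_m) (Psi : 'M[C]_(m, n)).
Variables (B : 'M[C]_m) (Bs : S -> 'M[C]_m).
Variables (theta : 'M[C]_n) (thetas : S -> 'M[C]_n).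
Variables (U : 'M[C]_m) (Us : S -> 'M[C]_m) (V : 'M[C]_n) (Vs : S -> 'M[C]_n).
Variables (d : 'rV[C]_m) (ds : S -> 'rV[C]_m).
Variables (w : 'rV[C]_n) (ws : S -> 'rV[C]_n).
Hypothesis rho_herm : rho ^t* = rho.
Hypothesis rho_ge0 : forall v : 'rV[C]_m, 0 <= (v *m rho *m v ^t*) 0 0.
Hypothesis B_herm : B ^t* = B.
Hypothesis Bs_herm : forall s, (Bs s) ^t* = Bs s.
Hypothesis B_sqr : B *m B = \sum_s Bs s *m Bs s.
Hypothesis theta_sum : theta = \sum_s thetas s.
Hypothesis U_unitary : U \is unitarymx.
Hypothesis Us_unitary : forall s, Us s \is unitarymx.
Hypothesis V_unitary : V \is unitarymx.
Hypothesis Vs_unitary : forall s, Vs s \is unitarymx.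
Hypothesis diagB : B *m rho *m B = U ^t* *m diag_mx d *m U.
Hypothesis diagBs :
  forall s, Bs s *m rho *m Bs s = (Us s) ^t* *m diag_mx (ds s) *m Us s.
Hypothesis diag_theta : theta = V *m diag_mx w *m V ^t*.
Hypothesis diag_thetas :
  forall s, thetas s = Vs s *m diag_mx (ws s) *m (Vs s) ^t*.
Hypothesis d_ge0 : forall j, 0 <= d 0 j.
Hypothesis ds_ge0 : forall s j, 0 <= ds s 0 j.
Hypothesis w_ge0 : forall k, 0 <= w 0 k.
Hypothesis ws_ge0 : forall s k, 0 <= ws s 0 k.
(** The support condition on the gradient enters here: a null eigenvector of [Bs s *m rho *m Bs s]
    is killed by [Bs s], so the coordinates of [Bs s *m Psi] vanish wherever [ds s] does, as
    [resolvent_scalar] requires. *)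
Hypothesis ker_Bs : forall s j, ds s 0 j = 0 -> row j (Us s *m Bs s) = 0.

(* With [K = B rho B], this is [rho B K^-1 B rho <= rho], tensored with theta
   and written in eigenbases of K and theta; it comes from expanding
   [0 <= <H | rho (x) theta | H>] at [H = G - B K^-1 B rho G]. *)
Lemma compressed_inverse_le s (G x : 'M[C]_(m, n)) :
  x = Us s *m (Bs s *m rho *m G) *m Vs s ->
  \sum_j \sum_k ws s 0 k * ((x j k)^* * x j k) / ds s 0 j <=
  \tr (G ^t* *m rho *m G *m thetas s).
Proof.
(* In the eigenbases, u is K^-1 applied to x; null eigenvalues get the inverse 0. *)
move=> x_def; pose u := \matrix_(j, k) (x j k / ds s 0 j).
pose H := G *m Vs s - Bs s *m (Us s) ^t* *m u.
have H0 : 0 <= \tr (H ^t* *m rho *m H *m diag_mx (ws s)).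
  rewrite /mxtrace; apply: sumr_ge0 => k _; rewrite mul_mx_diag mxE mulr_ge0 //.
  have := rho_ge0 (row k (H ^t*)).
  rewrite -row_mul; congr (0 <= _).
  rewrite [in LHS]mxE [in RHS]mxE; apply: eq_bigr => j _.
  by rewrite [in LHS]mxE !mxE conjCK.
rewrite -subr_ge0; apply: le_trans H0 _.
rewrite le_eqVlt; apply/orP; left; apply/eqP.
have UU := unitarymx_adjK (Us_unitary s); have /unitarymxP UU' := Us_unitary s.
have xE : x ^t* = (G *m Vs s) ^t* *m rho *m (Bs s *m (Us s) ^t*).
  by rewrite x_def !adjmxM rho_herm Bs_herm !mulmxA.
have xE' : x = (Bs s *m (Us s) ^t*) ^t* *m rho *m (G *m Vs s).
  by rewrite x_def adjmxM trmxCK Bs_herm !mulmxA.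
have dE : (Bs s *m (Us s) ^t*) ^t* *m rho *m (Bs s *m (Us s) ^t*) =
    diag_mx (ds s).
  rewrite adjmxM trmxCK Bs_herm.
  have -> : Us s *m Bs s *m rho *m (Bs s *m (Us s) ^t*) =
    Us s *m (Bs s *m rho *m Bs s) *m (Us s) ^t* by rewrite !mulmxA.
  by rewrite diagBs -!mulmxA UU' mulmx1 mulmxA UU' mul1mx.
have -> : H ^t* *m rho *m H = (G *m Vs s) ^t* *m rho *m (G *m Vs s)
   - x ^t* *m u - u ^t* *m x + u ^t* *m diag_mx (ds s) *m u.
  rewrite /H adjmxB (adjmxM _ u) !mulmxBl !mulmxBr -dE xE xE' !mulmxA.
  by rewrite opprB addrA addrAC.
rewrite !(mulmxDl, mulNmx) !(mxtraceD, raddfN (@mxtrace C n)) /=.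
have -> : \tr ((G *m Vs s) ^t* *m rho *m (G *m Vs s) *m diag_mx (ws s)) =
  \tr (G ^t* *m rho *m G *m thetas s).
  rewrite diag_thetas adjmxM -!mulmxA mxtrace_mulC !mulmxA.
  by congr (\tr _); rewrite !mulmxA.
(* Entrywise, each cross term contributes - w |x|^2 / d and the square of u contributes + w |x|^2 /
   d. *)
rewrite -!addrA; congr (_ + _).
rewrite trace_weightedE !trace_weighted_rightE -!sumrN -!big_split /=.
apply: eq_bigr => j _; rewrite -!sumrN -!big_split /=.
apply: eq_bigr => k _; rewrite /u mxE.
case: (eqVneq (ds s 0 j) 0) => [->|dN].
  by rewrite !(invr0, mulr0, mul0r, conjC0, oppr0, addr0).
have dC : (ds s 0 j)^* = ds s 0 j by apply: CrealP; rewrite realE ds_ge0.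
by rewrite rmorphM fmorphV /= dC; field.
Qed.

(* In operator form, with [K = B rho B] and [Delta = K^-1 (x) theta], the left
   side is [<B Psi | (Delta + t)^-1 | B Psi>], that is, the maximum over x of
   [2 Re <x | B Psi> - <x | Delta + t | x>].  Write the optimal x as [B rho G];
   the trial vectors [Bs s rho G] reach at least this value on the right. *)
Lemma resolvent_le (t : C) : 0 < t ->
  \sum_j \sum_k
    `|(U *m (B *m Psi) *m V) j k| ^+ 2 * d 0 j / (w 0 k + t * d 0 j) <=
  \sum_s \sum_j \sum_k
    `|(Us s *m (Bs s *m Psi) *m Vs s) j k| ^+ 2 * ds s 0 j
      / (ws s 0 k + t * ds s 0 j).
Proof.
move=> t0; set y := U *m _ *m V.
(* The maximiser has entries y / (w / d + t) = d * u. Solving G V = B U^-1 u makes B rho G, read in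
   the eigenbases, equal to it, since B rho B has eigenvalues d. *)
pose u := \matrix_(j, k) (y j k / (w 0 k + t * d 0 j)).
have [G GV] : exists G, G *m V = B *m U ^t* *m u.
  exists (B *m U ^t* *m u *m V ^t*).
  by rewrite -!mulmxA (unitarymx_adjK V_unitary) mulmx1.
pose x := U *m (B *m rho *m G) *m V.
pose z s := Us s *m (Bs s *m Psi) *m Vs s.
pose xs s := Us s *m (Bs s *m rho *m G) *m Vs s.
have /unitarymxP UU := U_unitary.
have t_real : t^* = t by apply: CrealP; rewrite realE ltW.
have dE : diag_mx d = U *m B *m rho *m B *m U ^t*.
  have -> : U *m B *m rho *m B = U *m (B *m rho *m B) by rewrite !mulmxA.
  by rewrite diagB !mulmxA UU mul1mx -!mulmxA UU mulmx1.
have x_def : x = diag_mx d *m u by rewrite dE /x -!mulmxA GV !mulmxA.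
have theta_tr : \tr (G ^t* *m rho *m G *m theta) =
    \sum_j \sum_k (u j k)^* * d 0 j * u j k * w 0 k.
  rewrite -trace_weightedE diag_theta.
  have -> : u ^t* *m diag_mx d *m u = (G *m V) ^t* *m rho *m (G *m V).
    by rewrite GV dE !adjmxM trmxCK B_herm !mulmxA.
  by rewrite adjmxM -!mulmxA [RHS]mxtrace_mulC !mulmxA.
have hsBs D E := hsprod_sum_sqr D E B_herm Bs_herm B_sqr.
have hs_xy : hsprod x y = \sum_s hsprod (xs s) (z s).
  rewrite hsprod_unitary // -mulmxA hsBs; apply: eq_bigr => s _.
  by rewrite mulmxA hsprod_unitary.
have hs_xx : hsprod x x = \sum_s hsprod (xs s) (xs s).
  rewrite hsprod_unitary // -mulmxA hsBs; apply: eq_bigr => s _.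
  by rewrite mulmxA hsprod_unitary.
(* The left side is the value of the variational expression at its maximiser x; the trace is the
   quadratic form of K^-1 (x) theta at x. *)
rewrite [leLHS](_ : _ = hsprod x y + hsprod y x - t * hsprod x x -
    \tr (G ^t* *m rho *m G *m theta)); last first.
  rewrite theta_tr !hsprodE mulr_sumr -!sumrN -!big_split /=.
  apply: eq_bigr => j _; rewrite mulr_sumr -!sumrN -!big_split /=.
  apply: eq_bigr => k _; rewrite x_def mul_diag_mx !mxE.
  have dC : (d 0 j)^* = d 0 j by apply: CrealP; rewrite realE d_ge0.
  have wC : (w 0 k)^* = w 0 k by apply: CrealP; rewrite realE w_ge0.
  case: (eqVneq (w 0 k + t * d 0 j) 0) => [->|cN].
    by rewrite !(invr0, mulr0, mul0r, conjC0, oppr0, addr0).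
  by rewrite !(rmorphM, fmorphV, rmorphD) /= dC wC t_real normCK; field.
rewrite -(hsprodC x y) hs_xy hs_xx theta_sum.
rewrite rmorph_sum mulmx_sumr (raddf_sum (@mxtrace C n)) mulr_sumr.
rewrite -!sumrN -!big_split /=.
apply: ler_sum => s _; rewrite hsprodC.
(* The trace with [thetas s] dominates the quadratic form of the s-th modular operator at [xs s];
   what remains is the scalar bound in each entry. *)
have := compressed_inverse_le (erefl (xs s)) => le_xs.
apply: le_trans (lerB (lexx _) le_xs) _.
rewrite !hsprodE mulr_sumr -!sumrN -!big_split /=.
apply: ler_sum => j _; rewrite mulr_sumr -!sumrN -!big_split /=.
apply: ler_sum => k _; rewrite -/(z s); apply: resolvent_scalar => // dsj.
rewrite /z mulmxA -mulmxA; set E := Psi *m Vs s.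
have := congr1 (fun r => (r *m E) 0 k) (ker_Bs dsj).
by rewrite mul0mx -row_mul !mxE.
Qed.

End Resolvent.
End HilbertSchmidt.

(** * Positive semidefinite matrices over R[i] *)

Section RealPart.
Local Open Scope complex_scope.
Variable R : realType.
Local Notation C := R[i].

Lemma Re_sum (I : Type) (r : seq I) (P : pred I) (F : I -> C) :
  complex.Re (\sum_(i <- r | P i) F i) = \sum_(i <- r | P i) complex.Re (F i).
Proof. exact: (raddf_sum (@complex.Re R : Rcomplex R -> R)). Qed.

Lemma ReD (x y : C) : complex.Re (x + y) = complex.Re x + complex.Re y.
Proof. by case: x y => a b [c d]. Qed.

Lemma ReN (x : C) : complex.Re (- x) = - complex.Re x.
Proof. by case: x. Qed.

Lemma ReM_real (a : R) (z : C) : complex.Re (a%:C * z) = a * complex.Re z.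
Proof. by case: z => b c /=; rewrite mul0r subr0. Qed.

Lemma Re_ge0 (x : C) : 0 <= x -> 0 <= complex.Re x.
Proof. by rewrite lecE => /andP[]. Qed.

Lemma ge0_ReK (x : C) : 0 <= x -> (complex.Re x)%:C = x.
Proof. by move=> x0; apply: RRe_real; rewrite realE x0. Qed.

Lemma ge0_Re_eq0 (x : C) : 0 <= x -> complex.Re x = 0 -> x = 0.
Proof. by move=> /ge0_ReK <- ->. Qed.

Lemma ge0_Re_ratio (a d w : C) (t : R) : 0 <= a -> 0 <= d -> 0 <= w ->
  a * d / (w + t%:C * d) =
  (complex.Re a * complex.Re d / (complex.Re w + t * complex.Re d))%:C.
Proof.
move=> a0 d0 w0.
by rewrite fmorph_div rmorphD !rmorphM /= !ge0_ReK.
Qed.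

End RealPart.

Section PositiveSemidefinite.
Local Open Scope complex_scope.
Local Open Scope sesquilinear_scope.
Variable R : realType.
Local Notation C := R[i].

Lemma psdmx_herm n (A : 'M[C]_n) : psdmx A -> A ^t* = A.
Proof. by case=> /is_hermitianmxP + _; rewrite expr0 scale1r => <-. Qed.

Lemma psdmxI n (A : 'M[C]_n) : A ^t* = A ->
  (forall v : 'rV[C]_n, 0 <= (v *m A *m v ^t*) 0 0) -> psdmx A.
Proof.
by move=> AA A0; split=> //; apply/is_hermitianmxP; rewrite expr0 scale1r AA.
Qed.

Lemma psdmx_sum n (I : Type) (r : seq I) (P : pred I) (A : I -> 'M[C]_n) :
  (forall i, P i -> psdmx (A i)) -> psdmx (\sum_(i <- r | P i) A i).
Proof.
move=> A_psd; apply: psdmxI => [|v].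
  rewrite raddf_sum map_mx_sum; apply: eq_bigr => i Pi.
  exact: psdmx_herm (A_psd i Pi).
rewrite mulmx_sumr mulmx_suml summxE.
by apply: sumr_ge0 => i Pi; have [_] := A_psd i Pi; apply.
Qed.

Lemma psdmx_congr m n (X : 'M[C]_(m, n)) (A : 'M[C]_m) :
  psdmx A -> psdmx (X ^t* *m A *m X).
Proof.
move=> A_psd; apply: psdmxI => [|v].
  by rewrite !adjmxM trmxCK (psdmx_herm A_psd) mulmxA.
have [_ /(_ (v *m X ^t*))] := A_psd.
by rewrite adjmxM trmxCK !mulmxA.
Qed.

Lemma psdmx_spectral n (A : 'M[C]_n) : psdmx A ->
  A = (spectralmx A) ^t* *m diag_mx (spectral_diag A) *m spectralmx A.
Proof.
case=> /hermitian_normalmx/orthomx_spectralP Ae _.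
by rewrite [LHS]Ae invmx_unitary ?spectral_unitarymx.
Qed.

Lemma mxfunE n (g : R -> R) (A : 'M[C]_n) :
  mxfun g A = (spectralmx A) ^t* *m
    diag_mx (map_mx (fun z : C => (g (complex.Re z))%:C) (spectral_diag A)) *m
    spectralmx A.
Proof. by rewrite /mxfun invmx_unitary ?spectral_unitarymx. Qed.

Lemma sqrtmx_herm n (A : 'M[C]_n) : (sqrtmx A) ^t* = sqrtmx A.
Proof. exact: mxfun_adj. Qed.

Lemma psdmx_kmap n (A rho : 'M[C]_n) : psdmx rho -> psdmx (kmap A rho).
Proof. by move=> /(psdmx_congr (sqrtmx A)); rewrite mxfun_adj. Qed.

(** In the two eigenbases the hypothesis reads a_i z_ij = z_ij b_j. A nonzero z_ij thus forces a_i =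
    b_j, hence h a_i = h b_j. *)
Lemma diag_intertwine m n (h : C -> C) (U : 'M[C]_m) (V : 'M[C]_n)
    (a : 'rV[C]_m) (b : 'rV[C]_n) (Z : 'M[C]_(m, n)) :
  U \is unitarymx -> V \is unitarymx ->
  U ^t* *m diag_mx a *m U *m Z = Z *m (V ^t* *m diag_mx b *m V) ->
  U ^t* *m diag_mx (map_mx h a) *m U *m Z =
  Z *m (V ^t* *m diag_mx (map_mx h b) *m V).
Proof.
move=> U_unit V_unit.
have /unitarymxP UU := U_unit; have UU' := unitarymx_adjK U_unit.
have /unitarymxP VV := V_unit; have VV' := unitarymx_adjK V_unit.
have UZV (D : 'M[C]_m) (E : 'M[C]_n) :
    (U ^t* *m D *m U *m Z = Z *m (V ^t* *m E *m V)) <->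
    (D *m (U *m Z *m V ^t*) = (U *m Z *m V ^t*) *m E).
  split=> [e|e].
    have := congr1 (fun M => U *m M *m V ^t*) e.
    by rewrite !mulmxA UU mul1mx => ->; rewrite -!mulmxA VV mulmx1.
  have := congr1 (fun M => U ^t* *m M *m V) e.
  by rewrite !mulmxA UU' mul1mx => <-; rewrite -!mulmxA VV' mulmx1.
move=> /UZV; rewrite mul_diag_mx mul_mx_diag => /matrixP e.
apply/UZV; rewrite mul_diag_mx mul_mx_diag; apply/matrixP => i j.
have := e i j; rewrite !mxE; set z := (\sum_k _).
case: (eqVneq z 0) => [->|z0]; first by rewrite !(mulr0, mul0r).
by rewrite mulrC => /(mulfI z0) ->; rewrite mulrC.
Qed.

Lemma mxfun_intertwine m n (g : R -> R) (A : 'M[C]_m) (B : 'M[C]_n) Z :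
  psdmx A -> psdmx B -> A *m Z = Z *m B -> mxfun g A *m Z = Z *m mxfun g B.
Proof.
move=> /psdmx_spectral Ae /psdmx_spectral Be; rewrite {1}Ae {1}Be !mxfunE.
by apply: diag_intertwine; exact: spectral_unitarymx.
Qed.

(** The functional calculus does not depend on the eigenbasis chosen by [spectralmx]: the identity
    intertwines any two diagonalisations of A. *)
Lemma mxfun_unitary n (g : R -> R) (A U : 'M[C]_n) (d : 'rV[C]_n) :
  psdmx A -> U \is unitarymx -> A = U ^t* *m diag_mx d *m U ->
  mxfun g A =
  U ^t* *m diag_mx (map_mx (fun z : C => (g (complex.Re z))%:C) d) *m U.
Proof.
move=> /psdmx_spectral Ae U_unit AU.
have := @diag_intertwine n n (fun z => (g (complex.Re z))%:C) (spectralmx A) U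
  (spectral_diag A) d 1%:M (spectral_unitarymx A) U_unit.
by rewrite mxfunE -Ae -AU !mulmx1 !mul1mx; apply.
Qed.

Lemma conjmxK m n (A : 'M[C]_(m, n)) : map_mx Num.conj (map_mx Num.conj A) = A.
Proof. by apply/matrixP => i j; rewrite !mxE conjCK. Qed.

(** The transpose of a Hermitian matrix is its entrywise conjugate, so its form at v is the
    conjugate of the form of A at the conjugate of v. *)
Lemma psdmx_tr n (A : 'M[C]_n) : psdmx A -> psdmx A^T.
Proof.
move=> A_psd; have AA := psdmx_herm A_psd.
have At : A^T = map_mx Num.conj A by rewrite -{1}AA map_trmx trmxK.
apply: psdmxI => [|v]; first by rewrite trmxK At.
have [_ /(_ (map_mx Num.conj v))] := A_psd.
suff -> : v *m A^T *m v ^t* =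
    map_mx Num.conj (map_mx Num.conj v *m A *m (map_mx Num.conj v) ^t*).
  by rewrite [X in _ -> 0 <= X]mxE conjC_ge0.
by rewrite At !map_mxM conjmxK map_trmx conjmxK.
Qed.

Lemma psdmx_trace_ge0 n (A : 'M[C]_n) : psdmx A -> 0 <= \tr A.
Proof.
case=> _ A0; apply: sumr_ge0 => i _.
have := A0 (delta_mx 0 i); rewrite trmx_delta map_delta_mx -rowE -colE.
by rewrite !mxE.
Qed.

(** Transposition keeps the eigenvalues and conjugates the eigenbasis. *)
Lemma entropy_tr n (A : 'M[C]_n) : psdmx A ->
  entropy A^T = entropy A.
Proof.
move=> A_psd; have Ae := psdmx_spectral A_psd.
pose U := map_mx Num.conj (spectralmx A).
have U_unit : U \is unitarymx.
  apply/unitarymxP; have /unitarymxP UU := spectral_unitarymx A.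
  by rewrite /U map_trmx -map_mxM UU map_mx1.
have UE (D : 'rV[C]_n) : ((spectralmx A) ^t* *m diag_mx D *m spectralmx A)^T =
    U ^t* *m diag_mx D *m U.
  by rewrite !trmx_mul tr_diag_mx mulmxA /U map_trmx conjmxK map_trmx trmxK.
have AtE : A^T = U ^t* *m diag_mx (spectral_diag A) *m U by rewrite {1}Ae UE.
have logE : logmx A^T = (logmx A)^T.
  rewrite /logmx (mxfun_unitary _ (psdmx_tr A_psd) U_unit AtE).
  by rewrite [in RHS]mxfunE UE.
by rewrite /entropy logE -trmx_mul mxtrace_tr mxtrace_mulC.
Qed.

End PositiveSemidefinite.

(** * The logarithmic inequality *)

Section Gap.
Local Open Scope complex_scope.
Local Open Scope sesquilinear_scope.
Variables (R : realType) (m n : nat) (E : finType).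
Local Notation C := R[i].
Variables (rho : 'M[C]_m) (Psi : E -> 'M[C]_(m, n)).
Hypothesis rho_psd : psdmx rho.
Implicit Type A : 'M[C]_m.

(** This is [theta A] of the overview. *)
Definition overlap A : 'M[C]_n := \sum_e Psi e ^t* *m A *m Psi e.

Definition gap A : R :=
  complex.Re (\tr (overlap A *m logmx (overlap A))) -
  complex.Re (\tr ((\sum_e Psi e *m Psi e ^t*) *m
                   kmap_adj A (logmx (kmap A rho)))).

(** The components of sqrt A psi_e in the eigenbasis of the relative modular operator: rows follow
    the eigenvectors of K, columns those of theta A. *)
Definition coords A e : 'M[C]_(m, n) :=
  spectralmx (kmap A rho) *m (sqrtmx A *m Psi e)
    *m (spectralmx (overlap A)) ^t*.

Local Notation dg A := (spectral_diag (kmap A rho)).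
Local Notation wg A := (spectral_diag (overlap A)).

Lemma overlap_psd A : psdmx A -> psdmx (overlap A).
Proof. by move=> A_psd; apply: psdmx_sum => e _; apply: psdmx_congr. Qed.

Lemma overlap_sum (S : finType) (As : S -> 'M[C]_m) :
  overlap (\sum_s As s) = \sum_s overlap (As s).
Proof.
rewrite exchange_big; apply: eq_bigr => e _.
by rewrite mulmx_sumr mulmx_suml.
Qed.

Lemma overlap_diag_coords A : psdmx A ->
  diag_mx (wg A) = \sum_e coords A e ^t* *m coords A e.
Proof.
move=> A_psd; have /psdmx_spectral := overlap_psd A_psd.
have /unitarymxP VV := spectral_unitarymx (overlap A).
have UU := unitarymx_adjK (spectral_unitarymx (kmap A rho)).
rewrite /coords; move: VV; move: (spectralmx (overlap A)) (wg A) => V w VV thE.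
move: (spectralmx (kmap A rho)) UU => U UU.
have -> : diag_mx w = V *m overlap A *m V ^t*.
  by rewrite thE !mulmxA VV mul1mx -!mulmxA VV mulmx1.
rewrite mulmx_sumr mulmx_suml; apply: eq_bigr => e _.
move: (sqrtmx_herm A) (sqrtmx_sqr A_psd); move: (sqrtmx A) => S SS S2.
rewrite !adjmxM trmxCK SS -{1}S2 -!mulmxA.
by rewrite (mulmxA (U ^t*)) UU mul1mx.
Qed.

Lemma overlap_diagE A k : psdmx A ->
  wg A 0 k = \sum_e \sum_j `|coords A e j k| ^+ 2.
Proof.
move=> /overlap_diag_coords/matrixP/(_ k k); rewrite mxE eqxx mulr1n => ->.
rewrite summxE; apply: eq_bigr => e _; rewrite mxE; apply: eq_bigr => j _.
by rewrite !mxE normCK mulrC.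
Qed.

(** The k-th eigenvalue of theta A is the sum of the squared moduli of all k-th columns of
    coordinates, so these vanish with it. *)
Lemma coords_eq0_overlap A e j k : psdmx A -> wg A 0 k = 0 ->
  coords A e j k = 0.
Proof.
move=> A_psd; rewrite overlap_diagE // => /eqP; rewrite psumr_eq0; last first.
  by move=> e' _; apply: sumr_ge0 => j' _; rewrite exprn_ge0.
move=> /allP/(_ e); rewrite mem_index_enum => /(_ isT) /=.
rewrite psumr_eq0; last by move=> j' _; rewrite exprn_ge0.
move=> /allP/(_ j); rewrite mem_index_enum => /(_ isT) /=.
by rewrite expf_eq0 /= normr_eq0 => /eqP.
Qed.

(** Let u be the j-th eigenvector, as a row. Its adjoint is in the kernel of K, hence in that of A
    by the support condition, and the squared norm of u sqrt A is the form of A at u. *)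
Lemma kmap_diag0_row A j : psdmx A -> (A <= kmap A rho)%MS -> dg A 0 j = 0 ->
  row j (spectralmx (kmap A rho) *m sqrtmx A) = 0.
Proof.
move=> A_psd /submxP[D AE] d0.
move: (sqrtmx_herm A) (sqrtmx_sqr A_psd); move: (sqrtmx A) => B BB B2.
set U := spectralmx _.
have /unitarymxP UU := spectral_unitarymx (kmap A rho).
have Kcol : kmap A rho *m (row j U) ^t* = 0.
  rewrite [kmap A rho](psdmx_spectral (psdmx_kmap A rho_psd)) -/U -!mulmxA.
  have -> : U *m (row j U) ^t* = delta_mx j 0.
    by rewrite rowE adjmxM trmx_delta map_delta_mx mulmxA UU mul1mx.
  rewrite (_ : diag_mx _ *m _ = 0) ?mulmx0 //.
  apply/matrixP => a b; rewrite mul_diag_mx !mxE.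
  by case: eqP => [->|]; rewrite ?d0 ?mul0r ?mulr0.
have Acol : A *m (row j U) ^t* = 0 by rewrite AE -mulmxA Kcol mulmx0.
rewrite row_mul; set v := row j U *m _.
have vv : v *m v ^t* = 0.
  by rewrite /v adjmxM BB !mulmxA -(mulmxA (row j U)) B2 -mulmxA Acol mulmx0.
apply/matrixP => a k; rewrite ord1 mxE; apply/eqP.
move/matrixP/(_ 0 0): vv; rewrite !mxE => /eqP.
rewrite psumr_eq0 => [|i _]; last by rewrite !mxE mul_conjC_ge0.
move=> /allP/(_ k); rewrite mem_index_enum => /(_ isT) /=.
by rewrite !mxE mul_conjC_eq0.
Qed.

Lemma coords_eq0_kmap A e j k : psdmx A -> (A <= kmap A rho)%MS ->
  dg A 0 j = 0 -> coords A e j k = 0.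
Proof.
move=> A_psd A_le d0; rewrite /coords mulmxA -mulmxA.
set F := (X in _ *m X).
have := congr1 (fun r => (r *m F) 0 k) (kmap_diag0_row A_psd A_le d0).
by rewrite mul0mx -row_mul !mxE.
Qed.

(** The convention [ln 0 = 0] already implements the logarithm on the support. *)
Lemma log_supportE (x : R) : (if x == 0 then 0 else log2 x) = ln x / ln 2.
Proof. by case: eqP => [->|//]; rewrite ln0 // mul0r. Qed.

(** Both traces expand over the same weights |coords|^2, one through the eigenvalues of theta A and
    the other through those of K. *)
Lemma gapE A : psdmx A ->
  gap A = (\sum_e \sum_j \sum_k complex.Re (`|coords A e j k| ^+ 2) *
    (ln (complex.Re (wg A 0 k)) - ln (complex.Re (dg A 0 j)))) / ln 2.
Proof.
move=> A_psd; have /psdmx_spectral thE := overlap_psd A_psd.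
have /unitarymxP VV := spectral_unitarymx (overlap A).
pose g (z : C) : C :=
  ((if complex.Re z == 0 then 0 else log2 (complex.Re z)) : R)%:C.
have lg k (u : 'rV[C]_k) :
    map_mx g u = map_mx (fun z => (ln (complex.Re z) / ln 2)%:C) u.
  by apply/matrixP => a b; rewrite !mxE /g log_supportE.
rewrite /gap; have -> : \tr (overlap A *m logmx (overlap A)) =
    \sum_e \sum_j \sum_k
      (ln (complex.Re (wg A 0 k)) / ln 2)%:C * `|coords A e j k| ^+ 2.
  rewrite /logmx mxfunE (lg n) {1}thE.
  set V := spectralmx _ in VV *.
  have -> (X Y : 'M[C]_n) : V ^t* *m X *m V *m (V ^t* *m Y *m V) =
      V ^t* *m (X *m Y *m V).
    by rewrite !mulmxA -(mulmxA _ V) VV mulmx1.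
  rewrite mxtrace_mulC -(mulmxA _ V) VV mulmx1 mulmx_diag mxtrace_diag.
  transitivity (\sum_k (ln (complex.Re (wg A 0 k)) / ln 2)%:C * wg A 0 k).
    by apply: eq_bigr => k _; rewrite !mxE mulrC.
  under eq_bigr do rewrite {2}overlap_diagE // mulr_sumr.
  rewrite exchange_big; apply: eq_bigr => e _ /=.
  under eq_bigr do rewrite mulr_sumr.
  by rewrite exchange_big.
have -> : \tr ((\sum_e Psi e *m Psi e ^t*) *m kmap_adj A (logmx (kmap A rho))) =
    \sum_e \sum_j \sum_k
      (ln (complex.Re (dg A 0 j)) / ln 2)%:C * `|coords A e j k| ^+ 2.
  rewrite mulmx_suml (raddf_sum (@mxtrace C m)); apply: eq_bigr => e _ /=.
  (* The identity is inserted as [diag_mx (const_mx 1)] to match [trace_weightedE]. *)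
  transitivity (\tr (coords A e ^t* *m
      diag_mx (map_mx (fun z : C => (ln (complex.Re z) / ln 2)%:C) (dg A)) *m
      coords A e *m diag_mx (const_mx 1))).
    rewrite diag_const_mx mulmx1 /kmap_adj /logmx mxfunE (lg m) sqrtmx_herm.
    rewrite /coords; move: (sqrtmx_herm A); move: (sqrtmx A) => B BB.
    have VV' := unitarymx_adjK (spectral_unitarymx (overlap A)).
    move: (spectralmx (kmap A rho)) (diag_mx _) => U L.
    move: (spectralmx (overlap A)) VV VV' => V _ VV'.
    rewrite !adjmxM trmxCK BB -!mulmxA mxtrace_mulC -!mulmxA.
    by rewrite [RHS]mxtrace_mulC -!mulmxA VV' mulmx1.
  rewrite trace_weightedE; apply: eq_bigr => j _; apply: eq_bigr => k _.
  move: (coords A e j k) => z; rewrite !mxE mulr1 normCK mulrAC mulrC.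
  by rewrite (mulrC z).
rewrite !Re_sum -sumrB mulr_suml; apply: eq_bigr => e _.
rewrite !Re_sum -sumrB mulr_suml; apply: eq_bigr => j _.
rewrite !Re_sum -sumrB mulr_suml; apply: eq_bigr => k _.
by rewrite !ReM_real -mulrBl -mulrBl mulrC mulrA.
Qed.

Lemma gap_sum_le (S : finType) (As : S -> 'M[C]_m) :
  (forall s, psdmx (As s)) -> (forall s, (As s <= kmap (As s) rho)%MS) ->
  ((\sum_s As s)%R <= kmap (\sum_s As s)%R rho)%MS ->
  \sum_s gap (As s) <= gap (\sum_s As s).
Proof.
move=> As_psd As_le.
have A_psd : psdmx (\sum_s As s) by apply: psdmx_sum.
have th_sum := overlap_sum As.
have B_sqr : sqrtmx (\sum_s As s) *m sqrtmx (\sum_s As s) =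
    \sum_s sqrtmx (As s) *m sqrtmx (As s).
  rewrite (sqrtmx_sqr A_psd); apply: eq_bigr => s _.
  by rewrite (sqrtmx_sqr (As_psd s)).
move: (\sum_s As s) th_sum B_sqr A_psd => A th_sum B_sqr A_psd A_le.
under eq_bigr do rewrite gapE //.
have ln2_gt0 : 0 < ln (2 : R) by rewrite ln_gt0 ?ltr1n.
rewrite gapE // -mulr_suml ler_pM2r ?invr_gt0 //.
(* The comparison holds for each vector psi_e separately, with theta A, which collects all of them,
   kept fixed. *)
rewrite exchange_big; apply: ler_sum => e _ /=.
have psd_dg X j : psdmx X -> 0 <= dg X 0 j.
  by move=> _; exact: psdmx_spectral_ge0 (psdmx_kmap X rho_psd).
have psd_wg X k : psdmx X -> 0 <= wg X 0 k.
  by move=> X_psd; exact: psdmx_spectral_ge0 (overlap_psd X_psd).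
have sq0 X j k : 0 <= complex.Re (`|coords X e j k| ^+ 2).
  by rewrite Re_ge0 // exprn_ge0.
have dg0 X j k : psdmx X -> (X <= kmap X rho)%MS ->
    complex.Re (dg X 0 j) = 0 -> complex.Re (`|coords X e j k| ^+ 2) = 0.
  move=> X_psd X_le /(ge0_Re_eq0 (psd_dg X j X_psd)) d0.
  by rewrite (coords_eq0_kmap e k X_psd X_le d0) normr0 expr0n.
have wg0 X j k : psdmx X ->
    complex.Re (wg X 0 k) = 0 -> complex.Re (`|coords X e j k| ^+ 2) = 0.
  move=> X_psd /(ge0_Re_eq0 (psd_wg X k X_psd)) w0.
  by rewrite (coords_eq0_overlap e j X_psd w0) normr0 expr0n.
have Vspec X := adj_unitarymx (spectral_unitarymx (overlap X)).
have Uspec X := spectral_unitarymx (kmap X rho).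
have thE X : psdmx X -> overlap X =
    (spectralmx (overlap X)) ^t* *m diag_mx (wg X)
      *m ((spectralmx (overlap X)) ^t*) ^t*.
  by move=> X_psd; rewrite trmxCK; exact: psdmx_spectral (overlap_psd X_psd).
have kE X : sqrtmx X *m rho *m sqrtmx X =
   (spectralmx (kmap X rho)) ^t* *m diag_mx (dg X) *m spectralmx (kmap X rho).
  exact: psdmx_spectral (psdmx_kmap X rho_psd).
pose T := (S * ('I_m * 'I_n))%type; pose T' := ('I_m * 'I_n)%type.
have sumT (F : S -> 'I_m -> 'I_n -> R) :
    \sum_s \sum_j \sum_k F s j k = \sum_(q : T) F q.1 q.2.1 q.2.2.
  rewrite -(pair_bigA _ (fun s q => F s q.1 q.2)); apply: eq_bigr => s _.
  by rewrite pair_bigA.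
have sumT' (F : 'I_m -> 'I_n -> R) :
    \sum_j \sum_k F j k = \sum_(q : T') F q.1 q.2.
  by rewrite pair_bigA.
rewrite sumT sumT'.
apply: (@sum_ln_ratio_le_of_resolvent R T T'
  (fun q => complex.Re (`|coords (As q.1) e q.2.1 q.2.2| ^+ 2))
  (fun q => complex.Re (wg (As q.1) 0 q.2.2))
  (fun q => complex.Re (dg (As q.1) 0 q.2.1))
  (fun q => complex.Re (`|coords A e q.1 q.2| ^+ 2))
  (fun q => complex.Re (wg A 0 q.2))
  (fun q => complex.Re (dg A 0 q.1))) => //.
- by move=> q; exact: Re_ge0 (psd_wg _ _ (As_psd q.1)).
- by move=> q; exact: Re_ge0 (psd_dg _ _ (As_psd q.1)).
- by move=> q; exact: Re_ge0 (psd_wg _ _ A_psd).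
- by move=> q; exact: Re_ge0 (psd_dg _ _ A_psd).
- by move=> q; exact: wg0 _ _ _ (As_psd q.1).
- by move=> q; exact: dg0 _ _ _ (As_psd q.1) (As_le q.1).
- by move=> q; exact: wg0 _ _ _ A_psd.
- by move=> q; exact: dg0 _ _ _ A_psd A_le.
(* Equality of total weights: they are Hilbert-Schmidt norms, invariant under the changes of basis
   and preserved by the isometry of [hsprod_sum_sqr]. *)
- have sq X : \sum_j \sum_k complex.Re (`|coords X e j k| ^+ 2) =
      complex.Re (hsprod (sqrtmx X *m Psi e) (sqrtmx X *m Psi e)).
    rewrite -(hsprod_unitary _ _ (Uspec X) (Vspec X)) hsprodE Re_sum.
    apply: eq_bigr => j _; rewrite Re_sum; apply: eq_bigr => k _.
    by rewrite normCK mulrC.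
  have hs := @hsprod_sum_sqr C m n S (sqrtmx A) (fun s => sqrtmx (As s)) (Psi e)
    (Psi e) (sqrtmx_herm _) (fun s => sqrtmx_herm _) B_sqr.
  have sum_sq : \sum_s \sum_j \sum_k complex.Re (`|coords (As s) e j k| ^+ 2) =
      \sum_j \sum_k complex.Re (`|coords A e j k| ^+ 2).
    apply: etrans (esym (sq A)); rewrite hs Re_sum.
    by apply: eq_bigr => s _; exact: sq.
  pose a X j k := complex.Re (`|coords X e j k| ^+ 2).
  exact: etrans (esym (sumT (fun s => a (As s)))) (etrans sum_sq (sumT' (a A))).
move=> t t0.
have t0' : 0 < t%:C by rewrite ltcR.
have := @resolvent_le C m n S rho (Psi e) (sqrtmx A) (fun s => sqrtmx (As s))
  (overlap A) (fun s => overlap (As s))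
  (spectralmx (kmap A rho)) (fun s => spectralmx (kmap (As s) rho))
  ((spectralmx (overlap A)) ^t*) (fun s => (spectralmx (overlap (As s))) ^t*)
  (dg A) (fun s => dg (As s)) (wg A) (fun s => wg (As s))
  (psdmx_herm rho_psd) (rho_psd.2) (sqrtmx_herm _) (fun s => sqrtmx_herm _)
  B_sqr th_sum (Uspec _) (fun s => Uspec _) (Vspec _) (fun s => Vspec _)
  (kE _) (fun s => kE _) (thE _ A_psd) (fun s => thE _ (As_psd s))
  (fun j => psd_dg _ _ A_psd) (fun s j => psd_dg _ _ (As_psd s))
  (fun k => psd_wg _ _ A_psd) (fun s k => psd_wg _ _ (As_psd s))
  (fun s j => @kmap_diag0_row _ j (As_psd s) (As_le s)) t%:C t0'.
move=> res.
pose r X j k : R := complex.Re (`|coords X e j k| ^+ 2) * complex.Re (dg X 0 j)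
   / (complex.Re (wg X 0 k) + t * complex.Re (dg X 0 j)).
have sumC X : psdmx X ->
    (\sum_j \sum_k r X j k)%:C = \sum_j \sum_k
      `|coords X e j k| ^+ 2 * dg X 0 j / (wg X 0 k + t%:C * dg X 0 j).
  move=> X_psd; rewrite rmorph_sum; apply: eq_bigr => j _.
  rewrite rmorph_sum; apply: eq_bigr => k _.
  by rewrite ge0_Re_ratio ?exprn_ge0 ?psd_wg ?psd_dg.
have le_r : \sum_j \sum_k r A j k <= \sum_s \sum_j \sum_k r (As s) j k.
  rewrite -lecR (sumC A A_psd) (rmorph_sum (real_complex R)) /=.
  rewrite (eq_bigr _ (fun s _ => sumC (As s) (As_psd s))).
  exact: res.
have eq_le (x y : R) : x = y -> x <= y by move->.
exact: le_trans (eq_le _ _ (esym (sumT' (r A))))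
  (le_trans le_r (eq_le _ _ (sumT (fun s => r (As s))))).
Qed.

End Gap.

(** * Block-diagonal states and partial traces *)

Section Tensor.
Local Open Scope complex_scope.
Local Open Scope sesquilinear_scope.
Variable R : realType.
Local Notation C := R[i].

Lemma tensblock_tens m k (A : 'M[C]_m) (B : 'M[C]_k) r r' :
  tensblock (A *t B) r r' = B r r' *: A.
Proof. by apply/matrixP => i j; rewrite !mxE !mxtens_indexK /= mulrC. Qed.

Lemma tensblock_sum m k (I : Type) (s : seq I) (P : pred I)
    (A : I -> 'M[C]_(m * k)) r r' :
  tensblock (\sum_(i <- s | P i) A i) r r' =
  \sum_(i <- s | P i) tensblock (A i) r r'.
Proof.
apply/matrixP => i j; rewrite mxE !summxE.
by apply: eq_bigr => ? _; rewrite mxE.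
Qed.

Lemma tensblockZ m k c (A : 'M[C]_(m * k)) r r' :
  tensblock (c *: A) r r' = c *: tensblock A r r'.
Proof. by apply/matrixP => i j; rewrite !mxE. Qed.

Lemma tensblock_inj m k (A B : 'M[C]_(m * k)) :
  (forall r r', tensblock A r r' = tensblock B r r') -> A = B.
Proof.
move=> AB; apply/matrixP => x y.
case: (mxtens_indexP x) => i r; case: (mxtens_indexP y) => j r'.
by have /matrixP/(_ i j) := AB r r'; rewrite !mxE.
Qed.

Lemma tensblock_tensid m n k (Phi : 'M[C]_m -> 'M[C]_n) (A : 'M[C]_(m * k))
    r r' :
  tensblock (tensid Phi A) r r' = Phi (tensblock A r r').
Proof.
rewrite /tensid tensblock_sum (bigD1 r) //= [X in _ + X]big1 => [|a ar].
  rewrite addr0 tensblock_sum (bigD1 r') //= [X in _ + X]big1 => [|b br].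
    by rewrite addr0 tensblock_tens mxE !eqxx scale1r.
  by rewrite tensblock_tens mxE eqxx eq_sym (negPf br) scale0r.
rewrite tensblock_sum big1 // => b _.
by rewrite tensblock_tens mxE eq_sym (negPf ar) scale0r.
Qed.

Lemma ptracer_tens m k (A : 'M[C]_m) (B : 'M[C]_k) :
  ptracer (A *t B) = \tr B *: A.
Proof.
by rewrite scaler_suml; apply: eq_bigr => r _; rewrite tensblock_tens.
Qed.

Lemma ptracel_tens m k (A : 'M[C]_m) (B : 'M[C]_k) :
  ptracel (A *t B) = \tr A *: B.
Proof.
by apply/matrixP => r r'; rewrite !mxE tensblock_tens mxtraceZ mulrC.
Qed.

Lemma ptracer_sum m k (I : finType) (A : I -> 'M[C]_(m * k)) :
  ptracer (\sum_i A i) = \sum_i ptracer (A i).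
Proof.
rewrite /ptracer exchange_big; apply: eq_bigr => r _.
by rewrite tensblock_sum.
Qed.

Lemma ptracerZ m k c (A : 'M[C]_(m * k)) : ptracer (c *: A) = c *: ptracer A.
Proof.
by rewrite /ptracer scaler_sumr; apply: eq_bigr => r _; rewrite tensblockZ.
Qed.

Lemma ptracel_sum m k (I : finType) (A : I -> 'M[C]_(m * k)) :
  ptracel (\sum_i A i) = \sum_i ptracel (A i).
Proof.
apply/matrixP => r r'; rewrite mxE summxE tensblock_sum.
rewrite (raddf_sum (@mxtrace C m)).
by apply: eq_bigr => i _; rewrite mxE.
Qed.

Lemma ptracelZ m k c (A : 'M[C]_(m * k)) : ptracel (c *: A) = c *: ptracel A.
Proof. by apply/matrixP => r r'; rewrite !mxE tensblockZ mxtraceZ. Qed.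

Lemma mxtrace_delta_diag k (a : 'I_k) : \tr (delta_mx a a : 'M[C]_k) = 1.
Proof.
rewrite /mxtrace (bigD1 a) //= [X in _ + X]big1 => [|i ia].
  by rewrite mxE !eqxx addr0.
by rewrite mxE (negPf ia).
Qed.

(* The isometry [|a> (x) 1]. *)
Definition embmx k n (a : 'I_k) : 'M[C]_(k * n, n) :=
  \matrix_(i, j) (i == mxtens_index (a, j))%:R.

Lemma embmx_adjM k n (a b : 'I_k) :
  (embmx n a) ^t* *m embmx n b = (a == b)%:R%:M.
Proof.
apply/matrixP => i j; rewrite !mxE (bigD1 (mxtens_index (a, i))) //=.
rewrite [X in _ + X]big1 => [|x xa].
  rewrite addr0 !mxE eqxx conjC1 mul1r (can_eq (@mxtens_indexK _ _)) xpair_eqE.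
  by case: (a == b); rewrite ?mul1r //= mul0rn.
by rewrite !mxE (negPf xa) conjC0 mul0r.
Qed.

Lemma delta_tens_embmx k n (a : 'I_k) (B : 'M[C]_n) :
  delta_mx a a *t B = embmx n a *m B *m (embmx n a) ^t*.
Proof.
apply/matrixP => x y.
case: (mxtens_indexP x) => b i; case: (mxtens_indexP y) => c j.
rewrite tensmxE !mxE.
transitivity ((b == a)%:R * (c == a)%:R * B i j).
  by congr (_ * _); rewrite -natrM mulnb.
rewrite (bigD1 j) //= [X in _ + X]big1 => [|l lj]; last first.
  rewrite !mxE (can_eq (@mxtens_indexK _ _)) xpair_eqE (eq_sym j) (negPf lj).
  by rewrite andbF conjC0 mulr0.
rewrite addr0 !mxE (bigD1 i) //= [X in _ + X]big1 => [|l li]; last first.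
  rewrite !mxE (can_eq (@mxtens_indexK _ _)) xpair_eqE (eq_sym i) (negPf li).
  by rewrite andbF mul0r.
rewrite !mxE !(can_eq (@mxtens_indexK _ _)) !xpair_eqE !eqxx !andbT addr0.
by rewrite conjC_nat mulrAC.
Qed.

(** The isometries [embmx] intertwine the whole operator with its blocks, hence also the logarithms,
    so the trace splits without diagonalising the sum. Injectivity of c makes the blocks
    orthogonal. *)
Lemma entropy_blockdiag (T : finType) k n (c : T -> 'I_k) (B : T -> 'M[C]_n) :
  injective c -> (forall t, psdmx (B t)) ->
  entropy (\sum_t delta_mx (c t) (c t) *t B t) = \sum_t entropy (B t).
Proof.
move=> c_inj B_psd.
have NE : \sum_t delta_mx (c t) (c t) *t B t =
    \sum_t embmx n (c t) *m B t *m (embmx n (c t)) ^t*.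
  by apply: eq_bigr => t _; rewrite delta_tens_embmx.
have N_psd : psdmx (\sum_t embmx n (c t) *m B t *m (embmx n (c t)) ^t*).
  apply: psdmx_sum => t _; have := psdmx_congr ((embmx n (c t)) ^t*) (B_psd t).
  by rewrite trmxCK.
rewrite NE; set N := \sum_t _ in N_psd *.
have NZ t : N *m embmx n (c t) = embmx n (c t) *m B t.
  rewrite mulmx_suml (bigD1 t) //= [X in _ + X]big1 => [|u ut].
    by rewrite addr0 -mulmxA embmx_adjM eqxx mulmx1.
  rewrite -mulmxA embmx_adjM (inj_eq c_inj) (negPf ut).
  by rewrite mul_mx_scalar scale0r.
have logNZ t : logmx N *m embmx n (c t) = embmx n (c t) *m logmx (B t).
  exact: mxfun_intertwine.
rewrite /entropy {1}/N mulmx_suml (raddf_sum (@mxtrace C _)) Re_sum -sumrN.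
apply: eq_bigr => t _; congr (- complex.Re _).
move: (logmx N) (logmx (B t)) (logNZ t) => L l LZ.
rewrite -2!mulmxA [LHS]mxtrace_mulC -2!mulmxA LZ (mulmxA (_ ^t*)).
by rewrite embmx_adjM eqxx mul1mx.
Qed.

End Tensor.

(** * The measured state *)

Section Measurement.
Local Open Scope complex_scope.
Local Open Scope sesquilinear_scope.
Variables (R : realType) (n : nat) (S P X : finType).
Local Notation C := R[i].
Variables (M : S -> P -> 'M[C]_n) (t : S -> P -> X).
Variable omega : 'M[C]_(n * n).
Hypothesis omega_psd : psdmx omega.
Local Notation nu := (tensid (channel M t) omega).

(** The psi_e are the columns of sqrt omega, reshaped into matrices with rows in Q and columns in
    R. *)
Definition psi (e : 'I_(n * n)) : 'M[C]_n :=
  \matrix_(i, r) sqrtmx omega (mxtens_index (i, r)) e.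

Lemma tensblock_psi r r' i j :
  tensblock omega r r' i j = \sum_e psi e i r * (psi e j r')^*.
Proof.
rewrite /psi; move: (sqrtmx omega) (sqrtmx_herm omega) (sqrtmx_sqr omega_psd).
move=> B BB <-; rewrite !mxE; apply: eq_bigr => e _; rewrite !mxE.
by congr (_ * _); rewrite -[in LHS]BB !mxE.
Qed.

Lemma ptracer_psi : ptracer omega = \sum_e psi e *m psi e ^t*.
Proof.
apply/matrixP => i j; rewrite !summxE.
under eq_bigr do rewrite tensblock_psi.
rewrite exchange_big; apply: eq_bigr => e _; move: (psi e) => Y; rewrite mxE.
by apply: eq_bigr => r _; rewrite !mxE.
Qed.

Lemma trace_tensblock_psi A r r' :
  \tr (tensblock omega r r' *m A) = (overlap psi A) r' r.
Proof.
rewrite /overlap summxE.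
transitivity (\sum_i \sum_j \sum_e psi e i r * (psi e j r')^* * A j i).
  apply: eq_bigr => i _; rewrite mxE; apply: eq_bigr => j _.
  by rewrite tensblock_psi mulr_suml.
under eq_bigr do rewrite exchange_big.
rewrite exchange_big; apply: eq_bigr => e _ /=; move: (psi e) => Y; rewrite mxE.
apply: eq_bigr => i _; rewrite !mxE mulr_suml; apply: eq_bigr => j _.
by rewrite !mxE -mulrA mulrC.
Qed.

Lemma ptracer_channel (sigma : 'M[C]_n) :
  ptracer (channel M t sigma) =
  \sum_s \sum_p \tr (sigma *m M s p) *: (basis_proj R s *t basis_proj R p).
Proof.
rewrite ptracer_sum; apply: eq_bigr => s _.
rewrite ptracer_sum; apply: eq_bigr => p _.
by rewrite ptracerZ ptracer_tens mxtrace_delta_diag scale1r.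
Qed.

(* The state of R after outcome A; the transpose is due to [psi e] being read as
   a matrix from R to Q. *)
Definition postmeas (A : 'M[C]_n) : 'M[C]_n := (overlap psi A)^T.

Definition spidx (q : S * P) := mxtens_index (enum_rank q.1, enum_rank q.2).

Lemma basis_proj_tens s p : basis_proj R s *t basis_proj R p =
  delta_mx (spidx (s, p)) (spidx (s, p)).
Proof.
apply/matrixP => x y.
case: (mxtens_indexP x) => a b; case: (mxtens_indexP y) => c d.
rewrite tensmxE !mxE !(can_eq (@mxtens_indexK _ _)) !xpair_eqE -natrM mulnb.
by rewrite andbACA.
Qed.

Lemma marginalSPR_nu : marginalSPR nu =
  \sum_q delta_mx (spidx q) (spidx q) *t postmeas (M q.1 q.2).
Proof.
apply: tensblock_inj => r r'.
rewrite !tensblock_tensid ptracer_channel tensblock_sum pair_bigA.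
apply: eq_bigr => -[s p] _ /=.
by rewrite tensblock_tens mxE trace_tensblock_psi basis_proj_tens.
Qed.

(** Tracing out S adds up the blocks with the same p, and [overlap] is additive in the outcome. *)
Lemma marginalPR_nu : marginalPR nu =
  \sum_p delta_mx (enum_rank p) (enum_rank p) *t postmeas (povmP M p).
Proof.
apply: tensblock_inj => r r'.
rewrite !tensblock_tensid ptracer_channel tensblock_sum.
rewrite ptracel_sum; under eq_bigr do rewrite ptracel_sum.
rewrite exchange_big; apply: eq_bigr => p _ /=.
rewrite tensblock_tens mxE /povmP overlap_sum summxE scaler_suml.
apply: eq_bigr => s _; rewrite ptracelZ ptracel_tens mxtrace_delta_diag scale1r.
by rewrite trace_tensblock_psi.
Qed.

Lemma spidx_inj : injective spidx.
Proof.
move=> [s p] [s' p'] /(can_inj (@mxtens_indexK _ _)) [].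
by move=> /enum_rank_inj -> /enum_rank_inj ->.
Qed.

Hypothesis M_psd : forall s p, psdmx (M s p).

Lemma povmP_psd p : psdmx (povmP M p).
Proof. by apply: psdmx_sum => s _. Qed.

Lemma entropy_postmeas A : psdmx A ->
  entropy (postmeas A) =
  - complex.Re (\tr (overlap psi A *m logmx (overlap psi A))).
Proof.
by move=> A_psd; rewrite /postmeas entropy_tr //; exact: overlap_psd.
Qed.

Lemma postmeas_psd A : psdmx A -> psdmx (postmeas A).
Proof. by move=> A_psd; apply: psdmx_tr; exact: overlap_psd. Qed.

Lemma condent_nu : condent nu =
  \sum_s \sum_p entropy (postmeas (M s p)) -
  \sum_p entropy (postmeas (povmP M p)).
Proof.
rewrite /condent marginalSPR_nu marginalPR_nu !entropy_blockdiag.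
- by rewrite pair_bigA.
- exact: enum_rank_inj.
- by move=> p; exact: postmeas_psd (povmP_psd p).
- exact: spidx_inj.
- by move=> q; exact: postmeas_psd.
Qed.

(** Tracing out R commutes with the channel, so the statistics of X depend on omega only through its
    marginal on Q. *)
Lemma marginalX_nu x : marginalX nu (enum_rank x) (enum_rank x) =
  \tr (ptracer omega *m povmX M t x).
Proof.
rewrite /marginalX; have -> : ptracer nu = channel M t (ptracer omega).
  rewrite /ptracer; under eq_bigr do rewrite tensblock_tensid.
  rewrite /channel exchange_big; apply: eq_bigr => s _.
  rewrite exchange_big; apply: eq_bigr => p _.
  by rewrite -scaler_suml mulmx_suml (raddf_sum (@mxtrace C n)).
rewrite ptracel_sum summxE /povmX mulmx_sumr (raddf_sum (@mxtrace C n)).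
apply: eq_bigr => s _; rewrite ptracel_sum summxE mulmx_sumr.
rewrite (raddf_sum (@mxtrace C n)).
rewrite [RHS]big_mkcond; apply: eq_bigr => p _ /=.
rewrite ptracelZ ptracel_tens.
rewrite basis_proj_tens mxtrace_delta_diag scale1r !mxE.
rewrite (inj_eq enum_rank_inj) andbb eq_sym.
by case: (t s p == x); rewrite ?mulr1 ?mulr0.
Qed.

(** [gap_sum_le], summed over p, with entropy and gradient terms separated. Since W(rho) = Tr (rho
    gradW(rho)), this is a tangent bound at rho with no constant term. *)
Lemma condent_ge_gradW rho : psdmx rho -> gradW_defined M rho ->
  complex.Re (\tr (ptracer omega *m gradW M rho)) <= condent nu.
Proof.
move=> rho_psd [M_le P_le].
pose ov A := complex.Re (\tr (overlap psi A *m logmx (overlap psi A))).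
pose gr A :=
  complex.Re (\tr (ptracer omega *m kmap_adj A (logmx (kmap A rho)))).
have gapP p : \sum_s gap rho psi (M s p) <= gap rho psi (povmP M p).
  by apply: gap_sum_le => //; exact: P_le.
have gap_ov A : gap rho psi A = ov A - gr A by rewrite /gap -ptracer_psi.
have -> : complex.Re (\tr (ptracer omega *m gradW M rho)) =
    - \sum_s \sum_p gr (M s p) + \sum_p gr (povmP M p).
  rewrite /gradW mulmxDr mulmxN mxtraceD (raddfN (@mxtrace C n)) ReD ReN.
  congr (- _ + _); rewrite mulmx_sumr (raddf_sum (@mxtrace C n)) Re_sum //.
  apply: eq_bigr => s _.
  by rewrite mulmx_sumr (raddf_sum (@mxtrace C n)) Re_sum.
have ovM : \sum_s \sum_p entropy (postmeas (M s p)) =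
    - \sum_s \sum_p ov (M s p).
  rewrite -sumrN; apply: eq_bigr => s _; rewrite -sumrN; apply: eq_bigr => p _.
  exact: entropy_postmeas.
have ovP : \sum_p entropy (postmeas (povmP M p)) = - \sum_p ov (povmP M p).
  rewrite -sumrN; apply: eq_bigr => p _.
  exact: entropy_postmeas (povmP_psd p).
have gapM : \sum_p \sum_s gap rho psi (M s p) =
    \sum_s \sum_p ov (M s p) - \sum_s \sum_p gr (M s p).
  rewrite exchange_big -sumrB; apply: eq_bigr => s _.
  by rewrite -sumrB; apply: eq_bigr => p _; exact: gap_ov.
have gapPE : \sum_p gap rho psi (povmP M p) =
    \sum_p ov (povmP M p) - \sum_p gr (povmP M p).
  by rewrite -sumrB; apply: eq_bigr => p _; exact: gap_ov.
have le_gap : \sum_p \sum_s gap rho psi (M s p) <=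
    \sum_p gap rho psi (povmP M p).
  by apply: ler_sum => p _; exact: gapP.
move: le_gap; rewrite gapM gapPE condent_nu ovM ovP.
lra.
Qed.

End Measurement.

(** * From feasibility in step 2 to the bound on [Sigma q] *)

Theorem proposition4 (R : realType) (n : nat) (S P X : finType)
    (M : S -> P -> 'M[R[i]]_n) (t : S -> P -> X)
    (q0 : X -> R) (c0 c1 eps delta : R)
    (rho_star : 'M[R[i]]_n) (f : X -> R) :
  is_povm M ->
  is_prob q0 ->
  0 <= eps -> 0 <= delta ->
  step1_solution M t q0 c0 c1 eps rho_star ->
  gradW_defined M rho_star ->
  step2_optimal M t q0 c0 c1 delta rho_star f ->
  step2_feasible M t rho_star f ->
  min_tradeoff M t (fun q => \sum_x f x * q x).
Proof.
move=> [M_psd _] _ _ _ [xi [[rho_psd _] _ _] _] grad_def _ feas q _.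
apply: le_ereal_inf_tmp => _ [nu [[omega [omega_psd _] ->] nuX] <-].
rewrite lee_fin.
apply: le_trans (condent_ge_gradW t omega_psd M_psd rho_psd grad_def).
set rho := ptracer omega.
(* Feasibility paired with omega_Q: the trace is the sum over e of the traces of psi_e^* D psi_e,
   where D >= 0 is the slack of the constraint. *)
have rho_ge0 :
    0 <= \tr (rho *m (gradW M rho_star - \sum_x (f x)%:C%C *: povmX M t x)).
  rewrite /rho ptracer_psi // mulmx_suml (raddf_sum (@mxtrace _ n)).
  apply: sumr_ge0 => e _ /=; rewrite mxtrace_mulC mulmxA mxtrace_mulC mulmxA.
  exact: psdmx_trace_ge0 (psdmx_congr _ feas).
rewrite -subr_ge0; apply: le_trans (Re_ge0 rho_ge0) _; rewrite le_eqVlt.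
apply/orP; left; apply/eqP.
rewrite mulmxBr mxtraceD (raddfN (@mxtrace _ n)) ReD ReN; congr (_ - _).
rewrite mulmx_sumr (raddf_sum (@mxtrace _ n)) Re_sum; apply: eq_bigr => x _ /=.
(* Membership in [Sigma q] identifies Tr (omega_Q M_x), a diagonal entry of the X marginal, with q
   x. *)
rewrite -scalemxAr mxtraceZ ReM_real -(marginalX_nu M t omega x) nuX.
congr (_ * _).
rewrite summxE (bigD1 x) //= [X in _ + X]big1 => [|y yx].
  by rewrite !mxE !eqxx mulr1 addr0.
by rewrite !mxE (inj_eq enum_rank_inj) eq_sym (negPf yx) mulr0.
Qed.
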